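(* Let $(\mathcal{A},\varphi)$ be a noncommutative probability space and let $(X_1,\ldots,X_n)$ and $(Y_1,\ldots,Y_n)$ be mutually free families in $\mathcal{A}$. Then $$\varphi(X_1Y_1X_2Y_2\cdots X_nY_n)=\sum_{k=0}^{n-1}\ \sum_{0<i_1<\cdots<i_k<n}\varphi(Y_{i_1}\cdots Y_{i_k}Y_n)\prod_{j=0}^{k}\beta_{2(i_{j+1}-i_j)-1}\bigl(X_{i_j+1},Y_{i_j+1},X_{i_j+2},\ldots,Y_{i_{j+1}-1},X_{i_{j+1}}\bigr),$$ where for each sequence $0<i_1<\cdots<i_k<n$ one sets $i_0=0$ and $i_{k+1}=n$. Consequently, if $\mathcal{B}\subseteq\mathcal{A}$ is a von Neumann subalgebra containing $\{Y_1,\ldots,Y_{n-1}\}$ and free from $\{X_1,\ldots,X_n\}$, then the conditional expectation onto $\mathcal{B}$ satisfies $$E[X_1Y_1X_2\cdots Y_{n-1}X_n\mid\mathcal{B}]=\sum_{k=0}^{n-1}\ \sum_{0<i_1<\cdots<i_k<n}Y_{i_1}\cdots Y_{i_k}\prod_{j=0}^{k}\beta_{2(i_{j+1}-i_j)-1}\bigl(X_{i_j+1},Y_{i_j+1},\ldots,Y_{i_{j+1}-1},X_{i_{j+1}}\bigr),$$ with the same convention $i_0=0$, $i_{k+1}=n$ (and the empty product $Y_{i_1}\cdots Y_{i_k}$ for $k=0$ equal to $1$).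
   Context: A noncommutative probability space $(\mathcal{A},\varphi)$ is a von Neumann algebra $\mathcal{A}$ with a faithful, normal, tracial state $\varphi$. Unital subalgebras $(\mathcal{A}_i)_{i\in I}$ are free if $\varphi(a_1\cdots a_n)=0$ whenever $\varphi(a_k)=0$, $a_k\in\mathcal{A}_{i_k}$ for all $k$, and $i_j\neq i_{j+1}$ for $j=1,\ldots,n-1$; families of elements are free if the unital algebras they generate are free. Boolean cumulants are the multilinear functionals $\beta_n:\mathcal{A}^n\to\mathbb{C}$, $n\ge1$, determined recursively by $\varphi(X_1\cdots X_n)=\sum_{\pi\in \mathit{Int}(n)}\prod_{B\in\pi}\beta_{|B|}(X_i; i\in B)$, where $\mathit{Int}(n)$ is the set of partitions of $\{1,\ldots,n\}$ into intervals and arguments within a block are in increasing order of index. For a von Neumann subalgebra $\mathcal{B}\subseteq\mathcal{A}$, $E[\,\cdot\mid\mathcal{B}]$ is the unique $\varphi$-preserving conditional expectation: $E[Z\mid\mathcal{B}]$ is the unique element of $\mathcal{B}$ with $\varphi(ZW)=\varphi(E[Z\mid\mathcal{B}]W)$ for all $W\in\mathcal{B}$. *)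

(* Defs.v *)
From mathcomp Require Import all_boot all_order all_algebra complex.
From mathcomp Require Import all_classical all_reals all_analysis.

Set Implicit Arguments.
Unset Strict Implicit.
Unset Printing Implicit Defensive.

Import Order.TTheory GRing.Theory Num.Theory numFieldNormedType.Exports.

Local Open Scope ring_scope.

Record hilbertSpace (R : realType) := HilbertSpace {
  hs_sort :> completeNormedModType R[i];
  hs_dot : {dot hs_sort for Num.conj};
  hs_normE : forall u : hs_sort, `|u| ^+ 2 = hs_dot u u
}.

Section Operators.
Variables (R : realType) (H : hilbertSpace R).

Definition bounded_operator (T : H -> H) : Prop := linear T /\ continuous T.

Definition adjoint_pair (S T : H -> H) : Prop :=
  forall u v : H, hs_dot H (S u) v = hs_dot H u (T v).

Definition commutant (M : set (H -> H)) : set (H -> H) :=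
  [set T | bounded_operator T /\ forall S, M S -> T \o S = S \o T]%classic.

(* The equality with the bicommutant already makes M a unital algebra. *)
Definition von_neumann (M : set (H -> H)) : Prop :=
  [/\ (M `<=` bounded_operator)%classic,
      forall S, M S -> exists2 T, M T & adjoint_pair S T &
      commutant (commutant M) = M].

End Operators.

(* A von Neumann algebra of operators on vn_space, seen through a faithful
   unital representation vn_act of an abstract complex algebra with
   involution, so that its elements carry the ring notations. *)
Record vonNeumannAlgebra (R : realType) := VonNeumannAlgebra {
  vn_sort :> algType R[i];
  vn_star : vn_sort -> vn_sort;
  vn_space : hilbertSpace R;
  vn_act : vn_sort -> vn_space -> vn_space;
  vn_act_inj : injective vn_act;
  vn_actP : forall (c : R[i]) (a b : vn_sort) (u : vn_space),
    vn_act (c *: a + b) u = c *: vn_act a u + vn_act b u;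
  vn_act1 : forall u : vn_space, vn_act 1 u = u;
  vn_actM : forall (a b : vn_sort) (u : vn_space),
    vn_act (a * b) u = vn_act a (vn_act b u);
  vn_act_star : forall a : vn_sort,
    adjoint_pair (vn_act a) (vn_act (vn_star a));
  vn_range : von_neumann (range vn_act)
}.

Arguments vn_star {R A} : rename.
Arguments vn_act {R A} : rename.

Section NoncommutativeProbability.
Variables (R : realType) (A : vonNeumannAlgebra R).

Definition vn_le (a b : A) : Prop :=
  forall u : vn_space A, 0 <= hs_dot (vn_space A) (vn_act (b - a) u) u.

Definition vn_sup (D : set A) (x : A) : Prop :=
  (forall a, D a -> vn_le a x) /\
  (forall y, (forall a, D a -> vn_le a y) -> vn_le x y).

Definition directed (D : set A) : Prop :=
  (D !=set0)%classic /\
  (forall a b, D a -> D b -> exists c, [/\ D c, vn_le a c & vn_le b c]).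

Variable phi : {scalar A}.

Definition state : Prop :=
  (forall a : A, 0 <= phi (vn_star a * a)) /\ phi 1 = 1.

Definition faithful : Prop := forall a : A, phi (vn_star a * a) = 0 -> a = 0.

Definition normal : Prop :=
  forall (D : set A) (x : A),
    directed D -> (forall a, D a -> vn_le 0 a) -> vn_sup D x ->
    supremums (phi @` D)%classic (phi x).

Definition tracial : Prop := forall a b : A, phi (a * b) = phi (b * a).

Definition noncommutative_probability_space : Prop :=
  [/\ state, faithful, normal & tracial].

Definition von_neumann_subalgebra (B : set A) : Prop :=
  von_neumann (vn_act @` B)%classic.

Definition is_conditional_expectation (B : set A) (z e : A) : Prop :=
  B e /\ forall w, B w -> phi (z * w) = phi (e * w).

(* Junk value 0 if no such element exists. *)
Definition conditional_expectation (B : set A) (z : A) : A :=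
  xget 0 [set e | is_conditional_expectation B z e]%classic.

End NoncommutativeProbability.

Section Freeness.
Variables (K : comNzRingType) (A : algType K) (phi : {scalar A}).

Definition generated_algebra (S : set A) : set A :=
  [set a | forall B : set A,
     GRing.subalg_closed (mem B) -> (S `<=` B)%classic -> B a]%classic.

Definition free_subalgebras (I : Type) (B : I -> set A) : Prop :=
  forall (n : nat) (i : nat -> I) (a : nat -> A),
    (0 < n)%N ->
    (forall k, (k < n)%N -> B (i k) (a k) /\ phi (a k) = 0) ->
    (forall k, (k.+1 < n)%N -> i k <> i k.+1) ->
    phi (\prod_(k < n) a k) = 0.

Definition free_families (I : Type) (S : I -> set A) : Prop :=
  free_subalgebras (fun i => generated_algebra (S i)).

Definition free_pair (S T : set A) : Prop :=
  free_families (fun b : bool => if b then S else T).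

End Freeness.

Section BooleanCumulants.

Definition interval_block (n : nat) (B : {set 'I_n}) : bool :=
  [forall i in B, forall k in B, forall j : 'I_n,
     (i <= j <= k)%N ==> (j \in B)].

Definition interval_partition (n : nat) (P : {set {set 'I_n}}) : bool :=
  finset.partition P (finset.setTfor 'I_n) &&
  [forall B in P, interval_block B].

Variables (K : comNzRingType) (A : algType K) (phi : {scalar A}).

(* enum lists the elements of a block in increasing order. *)
Definition block_args (s : seq A) (B : {set 'I_(size s)}) : seq A :=
  [seq s`_i | i : 'I_(size s) <- enum B].

Fixpoint boolean_cumulant_rec (m : nat) (s : seq A) : K :=
  if m is m'.+1 then
    phi (\prod_(a <- s) a) -
    \sum_(P : {set {set 'I_(size s)}} | interval_partition P &&
            (P != finset.set1 (finset.setTfor 'I_(size s))))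
      \prod_(B in P) boolean_cumulant_rec m' (block_args B)
  else 0.

(* beta_n(a_1, ..., a_n) for s = [:: a_1; ...; a_n]: the moment-cumulant
   formula solved for the term of the one-block partition; m is fuel. *)
Definition boolean_cumulant (s : seq A) : K :=
  boolean_cumulant_rec (size s) s.

End BooleanCumulants.

Section Indices.

(* X_(a+1), Y_(a+1), X_(a+2), ..., Y_(b-1), X_b *)
Definition interleave (T : Type) (X Y : nat -> T) (a b : nat) : seq T :=
  rcons (flatten [seq [:: X l; Y l] | l <- index_iota a.+1 b]) (X b).

Lemma size_interleave (T : Type) (X Y : nat -> T) (a b : nat) :
  (a < b)%N -> size (interleave X Y a b) = ((b - a).*2 - 1)%N.
Proof.
move=> ab; rewrite size_rcons size_flatten /shape -map_comp.
rewrite (eq_map (g := fun=> 2%N)) // sumnE big_map big_const_seq count_predT.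
by rewrite size_iota iter_addn_0 subnS mul2n; case: (b - a)%N (subn_gt0 a b);
   rewrite ?ab // => d _; rewrite doubleS subn1.
Qed.

Definition increasing_tuple (n k : nat) (i : k.-tuple 'I_n) : bool :=
  path ltn 0%N [seq val l | l <- i].

(* i_0 = 0 and i_(k+1) = n *)
Definition cut_point (n k : nat) (i : k.-tuple 'I_n) (j : nat) : nat :=
  nth 0%N (0%N :: rcons [seq val l | l <- i] n) j.

End Indices.

Section MomentCumulant.
Variables (K : comNzRingType) (A : algType K) (phi : {scalar A}).

Lemma interval_partition1 (n : nat) :
  (0 < n)%N -> interval_partition (finset.set1 (finset.setTfor 'I_n)).
Proof.
move=> n0; apply/andP; split.
  apply/and3P; split; first by rewrite /finset.cover big_set1.
    by apply/finset.trivIsetP => B C /finset.set1P-> /finset.set1P->; rewrite eqxx.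
  apply/negP => /finset.set1P/finset.setP/(_ (Ordinal n0)).
  by rewrite finset.in_set0 finset.in_setT.
apply/forall_inP => B /finset.set1P->.
apply/forall_inP => i _; apply/forall_inP => k _; apply/forallP => j.
by rewrite finset.in_setT implybT.
Qed.

Lemma size_block_args (s : seq A) (P : {set {set 'I_(size s)}})
    (B : {set 'I_(size s)}) :
  interval_partition P -> P != finset.set1 (finset.setTfor 'I_(size s)) ->
  B \in P -> (0 < size (block_args B) < size s)%N.
Proof.
move=> /andP[/and3P[/eqP cP tP P0] _] PT BP; rewrite size_map -cardE card_gt0.
have BN C : C \in P -> C != finset.set0.
  by move=> CP; apply: contraNneq P0 => <-.
rewrite BN //= ltn_neqAle -[X in (_ <= X)%N](card_ord (size s)) max_card andbT.
apply: contra PT => /eqP BT.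
have {}BT : B = finset.setTfor 'I_(size s).
  by apply/eqP; rewrite finset.eqEcard finset.subsetT finset.cardsT card_ord BT /=.
apply/eqP/finset.setP => C; apply/idP/finset.set1P => [CP|-> //]; last by rewrite -BT.
apply: contraNeq (BN _ CP) => CB.
have := finset.trivIsetP tP _ _ CP BP; rewrite BT => /(_ CB).
by rewrite -finset.setI_eq0 finset.setIT.
Qed.

Lemma boolean_cumulant_fuel (m : nat) (s : seq A) :
  (0 < size s <= m)%N -> boolean_cumulant_rec phi m s = boolean_cumulant phi s.
Proof.
suff fuel p q t : (0 < size t <= p)%N -> (0 < size t <= q)%N ->
    boolean_cumulant_rec phi p t = boolean_cumulant_rec phi q t.
  by move=> sm; apply: fuel; rewrite // leqnn andbT; case/andP: sm.
elim: p q t => [|p IHp] [|q] t /andP[t0 tp] /andP[_ tq];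
  try by move: t0; rewrite ltnNge ?tp ?tq.
rewrite /=; congr (_ - _); apply: eq_bigr => P /andP[intP PT].
apply: eq_bigr => B BP; have /andP[B0 Bt] := size_block_args intP PT BP.
by apply: IHp; rewrite B0 -ltnS (leq_trans Bt).
Qed.

Lemma boolean_cumulantP (s : seq A) : s != [::] ->
  phi (\prod_(a <- s) a) =
  \sum_(P : {set {set 'I_(size s)}} | interval_partition P)
     \prod_(B in P) boolean_cumulant phi (block_args B).
Proof.
move=> s0; have n0 : (0 < size s)%N by case: (s) s0.
rewrite (bigD1 _ (interval_partition1 n0)) /= big_set1.
have -> : block_args (finset.setTfor 'I_(size s)) = s.
  rewrite /block_args finset.enum_setT -enumT.
  by rewrite -[RHS](mkseq_nth 0) /mkseq -val_enum_ord -map_comp.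
have -> : boolean_cumulant phi s = boolean_cumulant_rec phi (size s).-1.+1 s.
  by rewrite prednK.
rewrite /=.
rewrite -[LHS](subrK (\sum_(P : {set {set 'I_(size s)}} | interval_partition P &&
   (P != finset.set1 (finset.setTfor 'I_(size s))))
     \prod_(B in P) boolean_cumulant phi (block_args B))); congr (_ - _ + _).
apply: eq_bigr => P /andP[intP PT]; apply: eq_bigr => B BP.
have /andP[B0 Bt] := size_block_args intP PT BP.
by rewrite boolean_cumulant_fuel // B0 -ltnS prednK.
Qed.

End MomentCumulant.

(* Main.v *)
(* Let c(a) = a - phi(a) 1.  Inserting 1 = c + phi between consecutive letters
   shows that beta(a_1, ..., a_m) = phi(a_1 c(a_2 c(... c(a_m)))), and, by looking
   at the rightmost phi, that a_1 ... a_m is the sum over j of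
   beta(a_(j+1), ..., a_m) a_1 ... a_j, up to the term a_1 c(a_2 c(... c(a_m))).
   For letters X_1, Y_1, ..., X_m freeness makes c(X_l c(Y_l c(... c(X_m)))) a
   combination of centered alternating words ending in an X.  Such a combination
   stays orthogonal to the algebra of the Y's, and so does its product by Y_(l-1):
   cumulants beginning with a Y and ending with an X vanish.  Only the cuts
   following a Y survive, which gives the formula by induction on the last cut. *)
Require Import Defs.
From mathcomp Require Import all_boot all_order all_algebra complex.
From mathcomp Require Import all_classical all_reals all_analysis.

Set Implicit Arguments.
Unset Strict Implicit.
Unset Printing Implicit Defensive.

Import Order.TTheory GRing.Theory Num.Theory numFieldNormedType.Exports.

Local Open Scope ring_scope.

(** * Interval partitions, sorted by their last block *)

Section IntervalPartitions.
Variable N : nat.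
Implicit Types (P : {set {set 'I_N}}) (B : {set 'I_N}) (j m : nat).

Definition segment j m : {set 'I_N} := [set i : 'I_N | (j <= i < m)%N]%SET.

(** Partitions of an initial segment stay sets of subsets of the fixed type ['I_N], so that deleting
    the last block changes no type. *)
Definition segment_partition m P : bool :=
  finset.partition P (segment 0 m) && [forall B in P, interval_block B].

Lemma segment0 j : segment j j = finset.set0.
Proof. by apply/finset.setP => i; rewrite !finset.inE; case: ltngtP. Qed.

Lemma interval_block_segment j m : interval_block (segment j m).
Proof.
apply/forall_inP => i; rewrite finset.inE => /andP[ji _].
apply/forall_inP => k; rewrite finset.inE => /andP[_ km].
apply/forallP => l; apply/implyP => /andP[il lk].
by rewrite finset.inE (leq_trans ji il) (leq_ltn_trans lk km).
Qed.

Lemma segment_inj m (j k : 'I_N) :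
  (j < m)%N -> (k < m)%N -> segment j m = segment k m -> j = k.
Proof.
move=> jm km jk; apply/val_inj/eqP; rewrite /= eqn_leq.
have := finset.in_setT k; have := erefl (k \in segment k m).
rewrite -{1}jk !finset.inE leqnn km !andbT => -> _ /=.
have := erefl (j \in segment j m).
by rewrite {1}jk !finset.inE leqnn jm !andbT => ->.
Qed.

Lemma segment_partition0 P : segment_partition 0 P = (P == finset.set0).
Proof.
rewrite /segment_partition segment0 finset.partition_set0.
by case: eqP => // ->; apply/forall_inP => B; rewrite finset.in_set0.
Qed.

Lemma last_block m P : (m < N)%N -> segment_partition m.+1 P ->
  exists2 j : 'I_N, (j <= m)%N & segment j m.+1 \in P.
Proof.
move=> mN /andP[partP /forall_inP intP].
pose o := Ordinal mN; have oP : o \in finset.cover P.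
  by rewrite (finset.cover_partition partP) finset.inE /=.
have [BP oB] := (finset.pblock_mem oP, finset.mem_pblock P o).
rewrite oP in oB; set B := finset.pblock P o in BP oB.
pose j := [arg min_(i < o in B) val i]%N.
have [jB jmin] : j \in B /\ forall k, k \in B -> (j <= k)%N.
  by rewrite /j; case: arg_minnP.
exists j; first exact: (jmin o).
suff -> : segment j m.+1 = B by [].
apply/finset.setP => k; rewrite finset.inE; apply/idP/idP => [/andP[jk km]|kB].
  have /forall_inP/(_ j jB)/forall_inP/(_ o oB)/forallP/(_ k) := intP _ BP.
  by rewrite jk -ltnS km.
rewrite jmin //=; have := fintype.subsetP (finset.partitionS partP BP) _ kB.
by rewrite finset.inE.
Qed.

Lemma segment_partition_last_uniq m P (j k : 'I_N) :
  (m < N)%N -> segment_partition m.+1 P -> (j <= m)%N -> (k <= m)%N ->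
  segment j m.+1 \in P -> segment k m.+1 \in P -> j = k.
Proof.
move=> mN /andP[/finset.partition_trivIset/finset.trivIsetP tP _] jm km jP kP.
apply: (@segment_inj m.+1) => //; apply: contraTeq isT => jk.
have /pred0P/(_ (Ordinal mN)) := tP _ _ jP kP jk.
by rewrite /= !finset.inE /= jm km leqnn.
Qed.

(** The condition [\notin P] expresses that deleting the block undoes adding it, as the reindexing
    below requires. *)
Lemma segment_partitionU1 m (j : nat) P :
  (m < N)%N -> (j <= m)%N ->
  (segment_partition m.+1 (segment j m.+1 |: P) && (segment j m.+1 \notin P))%SET =
  segment_partition j P.
Proof.
move=> mN jm.
have sD : (segment 0 m.+1 :\: segment j m.+1 = segment 0 j)%SET.
  apply/finset.setP => k; rewrite !finset.inE /=.
  by case: (ltnP k j) => //= kj; [rewrite ltnS (leq_trans (ltnW kj)) | rewrite andNb].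
have sU : (segment j m.+1 :|: segment 0 j = segment 0 m.+1)%SET.
  apply/finset.setP => k; rewrite !finset.inE /=.
  by case: (ltnP k j) => //= kj; rewrite ?orbF // ltnS (leq_trans (ltnW kj)).
have mB : Ordinal mN \in segment j m.+1 by rewrite finset.inE /= jm leqnn.
apply/andP/andP => [[/andP[partP /forall_inP intP] sP]|[partP /forall_inP intP]].
  split; last by apply/forall_inP => B BP; apply: intP; rewrite finset.inE BP orbT.
  by rewrite -sD -[P](finset.setU1K sP) finset.partitionD1 ?finset.setU11.
have sP : segment j m.+1 \notin P.
  apply/negP => /(finset.partitionS partP)/fintype.subsetP/(_ _ mB).
  by rewrite finset.inE /= ltnNge jm.
split=> //; apply/andP; split.
  rewrite -sU finset.partitionU1 //; first by apply/finset.set0Pn; exists (Ordinal mN).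
  apply/pred0P => k; rewrite /= !finset.inE /=.
  by case: (leqP j k) => //=; rewrite andbF.
by apply/forall_inP => B /finset.setU1P[->|/intP //]; exact: interval_block_segment.
Qed.

(** Partitions are sorted by the start [j] of their last block; what remains is an arbitrary
    interval partition of the first [j] points. *)
Lemma sum_segment_partition (K : comNzRingType) (f : {set 'I_N} -> K) m :
  (m < N)%N ->
  \sum_(P | segment_partition m.+1 P) \prod_(B in P) f B =
  \sum_(j < m.+1) f (segment j m.+1) *
     \sum_(P | segment_partition j P) \prod_(B in P) f B.
Proof.
move=> mN.
pose c P (j : 'I_N) := (j <= m)%N && (segment j m.+1 \in P).
transitivity (\sum_(P | segment_partition m.+1 P) \sum_(j | c P j) \prod_(B in P) f B).
  apply: eq_bigr => P segP; have [j jm jP] := last_block mN segP.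
  rewrite (big_pred1 j) // => k; apply/andP/eqP => [[km kP]|-> //].
  exact: segment_partition_last_uniq kP jP.
rewrite (exchange_big_dep (fun j : 'I_N => (j < m.+1)%N)) /=; last first.
  by move=> P j _ /andP[].
rewrite [RHS](big_ord_widen_cond N xpredT (fun j => f (segment j m.+1) *
     \sum_(P | segment_partition j P) \prod_(B in P) f B)) //.
apply: eq_bigr => j jm; rewrite big_distrr /=.
rewrite (reindex_onto (fun P => segment j m.+1 |: P)%SET
    (fun P => P :\ segment j m.+1)%SET) /=; last first.
  by move=> P /and3P[_ _ /finset.setD1K].
apply: eq_big => [P|P].
  rewrite -(segment_partitionU1 _ mN jm) /c -ltnS jm finset.setU11 /= andbT.
  congr (_ && _); apply/eqP/idP => [<-|/finset.setU1K //].
  by rewrite !finset.inE eqxx.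
case/andP=> _ /eqP PE; rewrite big_setU1 // -PE.
by rewrite !finset.inE eqxx.
Qed.

Lemma segment_partition_full P : segment_partition N P = interval_partition P.
Proof.
rewrite /segment_partition /interval_partition; congr (finset.partition _ _ && _).
by apply/finset.setP => i; rewrite !finset.inE ltn_ord.
Qed.

End IntervalPartitions.

Lemma block_args_segment (K : comNzRingType) (A : algType K) (s : seq A) (j m : nat) :
  (m <= size s)%N -> block_args (segment (size s) j m) = drop j (take m s).
Proof.
move=> ms; have [mj|jm] := leqP m j.
  rewrite drop_oversize ?size_takel // /block_args.
  suff -> : segment (size s) j m = finset.set0 by rewrite finset.enum_set0.
  apply/finset.setP => i; rewrite !finset.inE; case: (leqP j i) => //= ji.
  by apply/negbTE; rewrite -leqNgt (leq_trans mj ji).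
have -> : block_args (segment (size s) j m) =
    [seq s`_i | i <- [seq val i | i <- enum (segment (size s) j m)]].
  by rewrite -map_comp.
have -> : [seq val i | i <- enum (segment (size s) j m)] = iota j (m - j).
  transitivity [seq i <- iota 0 (size s) | (j <= i < m)%N].
    rewrite -val_enum_ord filter_map; congr map.
    by rewrite enumT; apply: eq_filter => i; rewrite /= finset.inE.
  have -> : iota 0 (size s) = iota 0 j ++ iota j (m - j) ++ iota m (size s - m).
    rewrite catA -[j in iota j (m - j)]add0n -iotaD subnKC ?(ltnW jm) //.
    by rewrite -[m in iota m (_ - m)]add0n -iotaD subnKC.
  rewrite !filter_cat (@eq_in_filter _ _ pred0) ?filter_pred0; last first.
    by move=> i; rewrite mem_iota /= add0n => ij; rewrite leqNgt ij.
  rewrite (@eq_in_filter _ _ predT) ?filter_predT; last first.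
    by move=> i; rewrite mem_iota subnKC ?(ltnW jm).
  rewrite (@eq_in_filter _ _ pred0) ?filter_pred0 ?cats0 // => i.
  by rewrite mem_iota /= => /andP[mi _]; rewrite [(i < m)%N]ltnNge mi andbF.
by rewrite map_nth_iota ?leq_sub2r // take_drop subnK // ltnW.
Qed.

(** * Boolean cumulants as means of nested centered products *)

Section CenteredProduct.
Variables (K : comNzRingType) (A : algType K) (phi : {scalar A}).

Definition centered (a : A) : A := a - phi a *: 1.

(** The last letter is set apart: [centered 1] is [0] as soon as [phi 1 = 1], so a uniform clause
    would make the product of every nonempty list vanish. *)
Fixpoint centered_product (s : seq A) : A :=
  if s is a :: s' then
    a * (if s' is [::] then 1 else centered (centered_product s'))
  else 1.

Lemma centered_product_cons (a : A) (s : seq A) : s != [::] ->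
  centered_product (a :: s) = a * centered (centered_product s).
Proof. by case: s. Qed.

Lemma centered_is_linear : linear centered.
Proof.
move=> c a b; rewrite /centered linearP scalerBr [(_ + _) *: _]scalerDl scalerA opprD.
by rewrite addrACA.
Qed.

Lemma phi_centered (a : A) : phi 1 = 1 -> phi (centered a) = 0.
Proof. by move=> phi1; rewrite /centered linearB linearZ /= phi1 mulr1 subrr. Qed.

(** Induction on the first letter: centering the product of the tail [t] subtracts
    [phi (centered_product t) *: 1], which accounts for the term [j = 1]; the other terms come from
    the tail. *)
Lemma prod_centered_product (s : seq A) :
  \prod_(a <- s) a = centered_product s +
    \sum_(1 <= j < size s) phi (centered_product (drop j s)) *: \prod_(a <- take j s) a.
Proof.
elim: s => [|a [|b s] IHs]; first by rewrite big_nil big_geq ?addr0.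
  by rewrite big_seq1 big_geq //= mulr1 addr0.
set t := b :: s in IHs *.
rewrite big_cons {1}IHs [in RHS]big_ltn // [in RHS]big_add1 /= big_seq1 addrA.
rewrite /centered mulrBr -scalerAr mulr1 subrK mulrDr mulr_sumr; congr (_ + _).
by apply: eq_bigr => j _; rewrite big_cons scalerAr.
Qed.

(** [prod_centered_product] under [phi] and [sum_segment_partition] give the same recursion: a last
    block starting at [j], and the prefix of length [j]. *)
Lemma sum_interval_partition_centered_product (s : seq A) : phi 1 = 1 ->
  \sum_(P : {set {set 'I_(size s)}} | interval_partition P)
     \prod_(B in P) phi (centered_product (block_args B)) =
  phi (\prod_(a <- s) a).
Proof.
move=> phi1; suff moments m : (m <= size s)%N ->
    \sum_(P : {set {set 'I_(size s)}} | segment_partition m P)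
       \prod_(B in P) phi (centered_product (block_args B)) =
    phi (\prod_(a <- take m s) a).
  by rewrite -(eq_bigl _ _ (@segment_partition_full (size s))) moments ?take_size.
elim/ltn_ind: m => -[_ _|m IHm ms].
  rewrite (eq_bigl _ _ (@segment_partition0 (size s))).
  by rewrite big_pred1_eq !big_set0 take0 big_nil phi1.
rewrite sum_segment_partition // prod_centered_product linearD linear_sum /=.
rewrite (size_takel ms) big_ord_recl; congr (_ + _).
  rewrite block_args_segment // drop0 (IHm 0%N) // take0 big_nil phi1 mulr1 //.
rewrite big_add1 /= big_mkord; apply: eq_bigr => j _.
rewrite block_args_segment // linearZ /= IHm ?take_takel //=.
- by rewrite ltnW // ltnS.
- by rewrite ltnS.
- by rewrite (leq_trans _ ms) // ltnW // ltnS.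
Qed.

(** Both sides satisfy the moment-cumulant formula. Blocks of the other partitions are shorter than
    [s], so induction on the size equates all terms but that of the one-block partition. *)
Lemma boolean_cumulantE (s : seq A) : phi 1 = 1 -> s != [::] ->
  boolean_cumulant phi s = phi (centered_product s).
Proof.
move=> phi1; have [m] := ubnP (size s); elim: m s => // m IHm s sm s0.
have s1 : (0 < size s)%N by case: (s) s0.
have TE : block_args (finset.setTfor 'I_(size s)) = s.
  transitivity (block_args (segment (size s) 0 (size s))).
    congr block_args; apply/finset.setP => i.
    by rewrite !finset.inE ltn_ord.
  by rewrite block_args_segment // take_size drop0.
have := sum_interval_partition_centered_product s phi1.
rewrite (boolean_cumulantP phi s0) !(bigD1 _ (interval_partition1 s1)) /= !big_set1 TE.
move=> E; apply/esym; move: E.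
rewrite (eq_bigr (fun P : {set {set 'I_(size s)}} =>
    \prod_(B in P) boolean_cumulant phi (block_args B))); first exact: addIr.
move=> P /andP[intP PT]; apply: eq_bigr => B BP.
have /andP[B0 Bs] := size_block_args intP PT BP.
by rewrite IHm ?(leq_trans Bs) // -size_eq0 -lt0n.
Qed.

End CenteredProduct.

Section GeneratedAlgebra.
Variables (K : comNzRingType) (A : algType K) (phi : {scalar A}).

Lemma generated_algebra_closed (S : set A) :
  GRing.subalg_closed (mem (generated_algebra S)).
Proof.
split=> [|c a b|a b]; rewrite !inE.
- by move=> B [B1 _ _] _; move: B1; rewrite inE.
- move=> aS bS B algB SB; have [_ + _] := algB => /(_ c a b).
  by rewrite !inE; apply; [apply: aS|apply: bS].
- move=> aS bS B algB SB; have [_ _] := algB => /(_ a b).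
  by rewrite !inE; apply; [apply: aS|apply: bS].
Qed.

Lemma sub_generated_algebra (S : set A) : (S `<=` generated_algebra S)%classic.
Proof. by move=> a Sa B _ SB; exact: SB. Qed.

Lemma free_pair_sym (S T : set A) : free_pair phi S T -> free_pair phi T S.
Proof.
move=> freeST n i a n0 aS ni.
apply: (freeST n (fun k => ~~ i k) a n0) => k kn; last first.
  by move=> /negb_inj; exact: ni.
by have := aS k kn; case: (i k).
Qed.

End GeneratedAlgebra.

(** * Centered alternating words over two free algebras *)

Section AlternatingWords.
Variables (K : comNzRingType) (A : algType K) (phi : {scalar A}).
Variable S : bool -> set A.

(* [b] and [e] index the algebras of the first and of the last letter. *)
Inductive alternating_word (e : bool) : bool -> A -> Prop :=
| alternating_word1 a : S e a -> phi a = 0 -> alternating_word e e a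
| alternating_wordM b a v : S b a -> phi a = 0 ->
    alternating_word e (~~ b) v -> alternating_word e b (a * v).

(** Words with either kind of first letter are mixed, as left multiplication may change it; only the
    last letter is tracked. *)
Inductive word_span (e : bool) : A -> Prop :=
| word_span0 : word_span e 0
| word_spanP c b v u : alternating_word e b v -> word_span e u ->
    word_span e (c *: v + u).

Lemma alternating_word_rcons (e b : bool) (v w : A) :
  alternating_word e b v -> S (~~ e) w -> phi w = 0 ->
  alternating_word (~~ e) b (v * w).
Proof.
move=> + Sw w0; elim=> [a Sa a0|b' a v' Sa a0 _ IHv].
  by apply: alternating_wordM => //; exact: alternating_word1.
by rewrite -mulrA; exact: alternating_wordM.
Qed.

Lemma word_span_word (e b : bool) (v : A) :
  alternating_word e b v -> word_span e v.
Proof.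
by move=> ev; rewrite -[v]addr0 -[v]scale1r; apply: word_spanP ev (word_span0 e).
Qed.

Lemma word_spanD (e : bool) (u v : A) :
  word_span e u -> word_span e v -> word_span e (u + v).
Proof.
move=> + ev; elim=> [|c b x y ex _ IHy]; first by rewrite add0r.
by rewrite -addrA; exact: word_spanP ex IHy.
Qed.

Lemma word_spanZ (e : bool) (c : K) (u : A) :
  word_span e u -> word_span e (c *: u).
Proof.
elim=> [|d b x y ex _ IHy]; first by rewrite scaler0; exact: word_span0.
by rewrite scalerDr scalerA; exact: word_spanP ex IHy.
Qed.

Hypothesis phi1 : phi 1 = 1.
Hypothesis freeS : free_subalgebras phi S.
Hypothesis algS : forall b, GRing.subalg_closed (mem (S b)).

Lemma phi_alternating_word (e b : bool) (v : A) :
  alternating_word e b v -> phi v = 0.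
Proof.
move=> ebv.
(* Freeness speaks of indexed products; with two algebras, alternation puts letter [k] into the
   algebra [b (+) odd k]. *)
suff [n [a [n0 aS ->]]] : exists n a, [/\ (0 < n)%N,
    forall k, (k < n)%N -> S (b (+) odd k) (a k) /\ phi (a k) = 0 &
    v = \prod_(k < n) a k].
  apply: (freeS (i := fun k => b (+) odd k)) => // k _ /=.
  by move=> /addbI; case: (odd k).
elim: ebv => [a Sa a0|b' a v' Sa a0 _ [n [w [n0 wS ->]]]].
  exists 1%N, (fun=> a); split => //; last by rewrite big_ord1.
  by case=> // _; rewrite addbF.
exists n.+1, (fun k => if k is k'.+1 then w k' else a); split => //.
  move=> [_|k kn]; first by rewrite addbF.
  by have := wS k kn; rewrite addNb addbN.
by rewrite big_ord_recl.
Qed.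

Lemma phi_word_span (e : bool) (u : A) : word_span e u -> phi u = 0.
Proof.
elim=> [|c b v x ev _ IHx]; first exact: linear0.
by rewrite linearP IHx (phi_alternating_word ev) mulr0 addr0.
Qed.

Lemma centered_closed (b : bool) (a : A) : S b a -> S b (centered phi a).
Proof.
have [S1 Slin _] := algS b; rewrite /centered addrC -scaleNr => Sa.
by have := Slin (- phi a) 1 a S1; rewrite !inE; apply.
Qed.

Lemma centeredK (a : A) : a = centered phi a + phi a *: 1.
Proof. by rewrite subrK. Qed.

(** [w] splits into a centered part, which lengthens each word by one letter, and a scalar, which
    rescales it; both results have mean zero. *)
Lemma phi_word_span_mul (e : bool) (u w : A) :
  word_span e u -> S (~~ e) w -> phi (u * w) = 0.
Proof.
move=> + Sw; elim=> [|c b v x ev eu IHx]; first by rewrite mul0r linear0.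
rewrite mulrDl linearD /= IHx addr0 -scalerAl linearZ /= [w]centeredK mulrDr.
rewrite linearD /= -scalerAr mulr1 linearZ /= (phi_alternating_word ev) mulr0 addr0.
have /phi_alternating_word-> := alternating_word_rcons ev (centered_closed Sw)
  (phi_centered w phi1).
by rewrite mulr0.
Qed.

Lemma subalg_closedM (b : bool) (x y : A) : S b x -> S b y -> S b (x * y).
Proof. by have [_ _ /(_ x y)] := algS b; rewrite !inE; apply. Qed.

Lemma centered_word_span (e : bool) (u : A) : word_span e u -> centered phi u = u.
Proof. by move=> eu; rewrite /centered (phi_word_span eu) scale0r subr0. Qed.

Lemma mul_word_span_neg (e b : bool) (y v : A) :
  S b y -> alternating_word e (~~ b) v -> word_span e (y * v).
Proof.
move=> Sy ev; rewrite [y]centeredK mulrDl -scalerAl mul1r addrC.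
apply: (word_spanP _ ev); apply: (word_span_word (b := b)).
apply: (alternating_wordM _ _ ev); first exact: centered_closed.
exact: phi_centered.
Qed.

(** If [y] and the first letter lie in the same algebra, they merge. When letters follow,
    [mul_word_span_neg] applies; otherwise the product is a single letter that need not be centered,
    a case that forces [b = e]. *)
Lemma mul_alternating_word (e b b' : bool) (y v : A) :
  S b y -> alternating_word e b' v ->
  word_span e (centered phi (y * v)) /\ (b != e -> word_span e (y * v)).
Proof.
move=> Sy ev; have [bb'|nbb'] := eqVneq b' b; last first.
  have bb' : b' = ~~ b by move: nbb'; case: (b); case: (b').
  have yv : word_span e (y * v) by apply: mul_word_span_neg Sy _; rewrite -bb'.
  by rewrite (centered_word_span yv).
case: ev bb' => [a Sa a0|{}b' a {}v Sa a0 ev] bb'; subst.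
  split=> [|/eqP//]; apply: word_span_word (alternating_word1 _ _).
    by apply: centered_closed; exact: subalg_closedM.
  exact: phi_centered.
have yav : word_span e (y * (a * v)).
  by rewrite mulrA; apply: mul_word_span_neg ev; exact: subalg_closedM.
by rewrite (centered_word_span yav).
Qed.

Lemma mul_word_span (e b : bool) (y u : A) :
  S b y -> word_span e u ->
  word_span e (centered phi (y * u)) /\ (b != e -> word_span e (y * u)).
Proof.
move=> Sy; elim=> [|c b' v x ev _ [IHx IHx']].
  by rewrite mulr0 /centered linear0 scale0r subr0; split=> [|_]; exact: word_span0.
have [yv yv'] := mul_alternating_word Sy ev.
rewrite mulrDr -scalerAr centered_is_linear; split=> [|be].
  by apply: word_spanD => //; exact: word_spanZ.
by apply: word_spanD; [apply: word_spanZ; exact: yv'|exact: IHx'].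
Qed.

End AlternatingWords.

(** * The sum over cuts and its recursion on the last cut *)

Section Expansion.
Variables (K : comNzRingType) (A : algType K) (n : nat) (Y : nat -> A).

Lemma interleave_diag (T : Type) (U V : nat -> T) (a : nat) :
  interleave U V a a.+1 = [:: U a.+1].
Proof. by rewrite /interleave /index_iota subnn. Qed.

Lemma interleave_ltn (T : Type) (U V : nat -> T) (a b : nat) : (a.+1 < b)%N ->
  interleave U V a b = U a.+1 :: V a.+1 :: interleave U V a.+1 b.
Proof. by move=> ab; rewrite /interleave /index_iota -subnSK. Qed.

Lemma interleave_neq0 (T : eqType) (U V : nat -> T) (a b : nat) :
  interleave U V a b != [::].
Proof. by rewrite -size_eq0 size_rcons. Qed.

(* The right-hand side of the expansion with [n] replaced by the last point [m],
   as an element of the algebra; the bound [b] on the number of cuts is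
   irrelevant as soon as [m <= b]. *)
Definition cut_sum (g : nat -> nat -> K) (b m : nat) : A :=
  \sum_(k < b) \sum_(i : k.-tuple 'I_n | path ltn 0%N (rcons [seq val l | l <- i] m))
    (\prod_(j < k.+1) g (nth 0%N (0%N :: rcons [seq val l | l <- i] m) j)
                        (nth 0%N (rcons [seq val l | l <- i] m) j)) *:
      \prod_(l <- i) Y l.

Lemma sum_rcons_tuple (V : nmodType) (k : nat) (P : pred (seq 'I_n)) (F : seq 'I_n -> V) :
  \sum_(i : k.+1.-tuple 'I_n | P i) F i =
  \sum_(l < n) \sum_(i : k.-tuple 'I_n | P (rcons i l)) F (rcons i l).
Proof.
rewrite pair_big_dep /=.
rewrite (reindex (fun p : 'I_n * k.-tuple 'I_n => [tuple of rcons p.2 p.1])) //=.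
apply: onW_bij; apply: inj_card_bij; last by rewrite card_prod !card_tuple !card_ord expnS.
by move=> [l i] [l' i'] /(congr1 val)/= /rcons_inj[/val_inj-> ->].
Qed.

(** Either there is no cut, or the last cut [l] contributes the factor [g l m] and the letter [Y l],
    leaving one cut fewer and the endpoint [l]. *)
Lemma cut_sumS (g : nat -> nat -> K) (b m : nat) : (0 < m <= n)%N ->
  cut_sum g b.+1 m = g 0%N m *: 1 +
    \sum_(1 <= l < m) g l m *: (cut_sum g b l * Y l).
Proof.
move=> /andP[m0 mn]; rewrite /cut_sum big_ord_recl /=; congr (_ + _).
  rewrite (big_pred1 [tuple]) => [|i]; first by rewrite big_ord1 big_nil.
  by rewrite (tuple0 i) /= m0 eqxx.
transitivity (\sum_(k < b) \sum_(1 <= l < m)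
   \sum_(i : k.-tuple 'I_n | path ltn 0%N (rcons [seq val l | l <- i] l))
    g l m *: ((\prod_(j < k.+1) g (nth 0%N (0%N :: rcons [seq val l | l <- i] l) j)
                        (nth 0%N (rcons [seq val l | l <- i] l) j)) *:
      \prod_(l <- i) Y l * Y l)).
  apply: eq_bigr => k _; rewrite /bump /= add1n.
  rewrite (sum_rcons_tuple k (fun s => path ltn 0%N (rcons [seq val l | l <- s] m))
   (fun s => (\prod_(j < k.+2) g (nth 0%N (0%N :: rcons [seq val l | l <- s] m) j)
                        (nth 0%N (rcons [seq val l | l <- s] m) j)) *:
      \prod_(l <- s) Y l)).
  set F := (X in _ = \sum_(1 <= l < m) X l).
  (* The index [0] may be added: [F 0] is an empty sum, since no strictly increasing path from [0]
     ends at [0]. *)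
  have -> : \sum_(1 <= l < m) F l = \sum_(l < n | (l < m)%N) F l.
    rewrite -big_ord_widen // -(big_mkord xpredT F) [RHS]big_ltn // {2}/F.
    rewrite big_pred0 ?add0r // => i; by rewrite rcons_path /= ltn0 andbF.
  rewrite [RHS]big_mkcond; apply: eq_bigr => l _.
  have pathE (i : k.-tuple 'I_n) :
      path ltn 0%N (rcons [seq val l | l <- rcons i l] m) =
      path ltn 0%N (rcons [seq val l | l <- i] l) && (l < m)%N.
    by rewrite map_rcons rcons_path last_rcons.
  rewrite (eq_bigl _ _ pathE); case: ifP => lm; last first.
    by rewrite big_pred0 // => i; rewrite andbF.
  rewrite /F; under eq_bigl do rewrite andbT.
  apply: eq_bigr => i _; rewrite big_rcons /= map_rcons -scalerAl scalerA.
  congr (_ *: _); have sk : size [seq val l | l <- i] = k by rewrite size_map size_tuple.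
  rewrite big_ord_recr /= mulrC !nth_rcons !size_rcons sk !ltnn !ltnSn !eqxx.
  congr (_ * _); apply: eq_bigr => -[j jk] _ /=.
  by rewrite -2!rcons_cons [in X in g X _]nth_rcons [in X in g _ X]nth_rcons
    /= !size_rcons sk jk leqW.
rewrite exchange_big /=; apply: eq_bigr => l _.
rewrite mulr_suml scaler_sumr; apply: eq_bigr => k _.
by rewrite mulr_suml scaler_sumr.
Qed.
End Expansion.

(** * Expansion of the alternating product of the [X] and [Y] under freeness *)

Section FreeExpansion.
Variables (K : comNzRingType) (A : algType K) (phi : {scalar A}).
Variables (S : bool -> set A) (n : nat) (X Y : nat -> A).
Hypothesis phi1 : phi 1 = 1.
Hypothesis freeS : free_subalgebras phi S.
Hypothesis algS : forall b, GRing.subalg_closed (mem (S b)).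
Hypothesis SX : forall i, (0 < i <= n)%N -> S true (X i).
Hypothesis SY : forall i, (0 < i < n)%N -> S false (Y i).

Local Notation T a m := (centered_product phi (interleave X Y a m)).

Lemma centered_product_interleave (a m : nat) : (a.+1 < m)%N ->
  T a m = X a.+1 * centered phi (Y a.+1 * centered phi (T a.+1 m)).
Proof.
move=> am; rewrite interleave_ltn // !centered_product_cons //.
exact: interleave_neq0.
Qed.

(** Starting from the centered [X m], each step multiplies on the left by a [Y], then by an [X],
    centering each time; [mul_word_span] keeps the result in the span. *)
Lemma word_span_interleave (a m : nat) : (a < m <= n)%N ->
  word_span phi S true (centered phi (T a m)).
Proof.
have [d] := ubnP (m - a); elim: d a => // d IHd a dma /andP[am mn].
have SXa : S true (X a.+1) by apply: SX; exact: leq_trans mn.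
have [ma|] := leqP m a.+1; last first.
  move=> am1; rewrite centered_product_interleave //.
  have IH : word_span phi S true (centered phi (T a.+1 m)).
    by apply: IHd; rewrite ?am1 // -ltnS (leq_trans _ dma) // ltnS ltn_sub2l.
  have SYa : S false (Y a.+1) by apply: SY; exact: leq_trans mn.
  have [+ _] := mul_word_span phi1 freeS algS SYa IH.
  by move=> /(mul_word_span phi1 freeS algS SXa)[].
have {ma am} -> : m = a.+1 by apply/eqP; rewrite eqn_leq ma.
rewrite interleave_diag /= mulr1; apply: word_span_word (alternating_word1 _ _).
  exact: centered_closed.
exact: phi_centered.
Qed.

(* This is [beta (Y_a, X_(a+1), Y_(a+1), ..., X_m) = 0]. *)
Lemma phi_Y_centered (a m : nat) : (0 < a < m)%N -> (m <= n)%N ->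
  phi (Y a * centered phi (T a m)) = 0.
Proof.
move=> /andP[a0 am] mn.
have SYa : S false (Y a) by apply: SY; rewrite a0 (leq_trans am).
have wT : word_span phi S true (centered phi (T a m)).
  by apply: word_span_interleave; rewrite am.
have [_ /(_ isT)] := mul_word_span phi1 freeS algS SYa wT.
exact: phi_word_span.
Qed.

(** This holds in the algebra itself, not only under [phi]: it is [prod_centered_product] without
    the prefixes ending in an [X], whose coefficients are cumulants starting with a [Y]. *)
Lemma interleave_expansion (a m : nat) : (a < m <= n)%N ->
  (\prod_(a.+1 <= i < m) (X i * Y i)) * X m =
  T a m + \sum_(a.+1 <= l < m) phi (T l m) *: \prod_(a.+1 <= i < l.+1) (X i * Y i).
Proof.
have [d] := ubnP (m - a); elim: d a => // d IHd a dma /andP[am mn].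
have [ma|am1] := leqP m a.+1.
  have {ma am} -> : m = a.+1 by apply/eqP; rewrite eqn_leq ma.
  by rewrite !big_geq // interleave_diag /= mul1r mulr1 addr0.
have Y0 : phi (Y a.+1 * centered phi (T a.+1 m)) = 0 by rewrite phi_Y_centered.
(* The vanishing mean removes the outer centering; the inner one, expanded below, produces the term
   [l = a.+1]. *)
rewrite centered_product_interleave // {1}/centered Y0 scale0r subr0.
rewrite [in LHS]big_ltn // -mulrA IHd ?am1 //; last first.
  by rewrite -ltnS (leq_trans _ dma) // ltnS ltn_sub2l.
rewrite [in RHS]big_ltn // big_nat1 /centered mulrDr mulrA addrA mulrBr.
rewrite -scalerAr mulr1 subrK; congr (_ + _).
rewrite mulr_sumr; apply: eq_big_nat => l /andP[al _].
by rewrite -scalerAr [in RHS]big_ltn // ltnS ltnW.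
Qed.

(** The centered part of [T 0 m] is orthogonal to [w], which yields the term without cuts. In the
    others the prefix ends in [Y l], which is absorbed into the test element; hence the
    quantification over [w]. *)
Lemma phi_expansion (b m : nat) (w : A) : (0 < m <= n)%N -> (m <= b)%N ->
  S false w ->
  phi ((\prod_(1 <= i < m) (X i * Y i)) * X m * w) =
  phi (cut_sum n Y (fun a c => boolean_cumulant phi (interleave X Y a c)) b m * w).
Proof.
elim: b m w => [|b IHb] m w /andP[m0 mn]; first by rewrite leqNgt m0.
move=> mb Sw; rewrite cut_sumS ?m0 // interleave_expansion ?m0 //.
rewrite !mulrDl !linearD /=; congr (_ + _).
  rewrite boolean_cumulantE ?interleave_neq0 // -scalerAl mul1r linearZ /=.
  rewrite [T 0 m in LHS](centeredK phi) mulrDl linearD /= -scalerAl mul1r linearZ /=.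
  rewrite (phi_word_span_mul phi1 freeS algS (e := true)) ?add0r //.
  by apply: word_span_interleave; rewrite m0.
rewrite !mulr_suml !linear_sum; apply: eq_big_nat => l /andP[l0 lm].
rewrite boolean_cumulantE ?interleave_neq0 // -!scalerAl !linearZ /=; congr (_ * _).
rewrite big_nat_recr //= mulrA -2!(mulrA _ (Y l) w).
have ln : (l < n)%N by rewrite (leq_trans lm).
apply: IHb; first by rewrite l0 ltnW.
  by rewrite -ltnS (leq_trans lm).
by apply: (subalg_closedM algS) => //; apply: SY; rewrite l0.
Qed.

End FreeExpansion.

(** * Von Neumann subalgebras and uniqueness of the conditional expectation *)

Section Subalgebras.
Variables (R : realType) (A : vonNeumannAlgebra R).

Lemma hs_dot_eq0 (H : hilbertSpace R) (u : H) : hs_dot H u u = 0 -> u = 0.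
Proof.
by rewrite -hs_normE => /eqP; rewrite expf_eq0 /= normr_eq0 => /eqP.
Qed.

Lemma adjoint_pair_uniq (H : hilbertSpace R) (T T1 T2 : H -> H) :
  adjoint_pair T T1 -> adjoint_pair T T2 -> T1 = T2.
Proof.
move=> TT1 TT2; apply/funext => v; apply/eqP; rewrite -subr_eq0; apply/eqP.
by apply: hs_dot_eq0; rewrite linearBr /= -TT1 -TT2 subrr.
Qed.

Variable B : set A.
Hypothesis vnB : von_neumann_subalgebra B.

Lemma vn_act_image (a : A) : (vn_act @` B)%classic (vn_act a) -> B a.
Proof. by case=> b Bb /vn_act_inj <-. Qed.

Lemma von_neumann_subalgebra_star (a : A) : B a -> B (vn_star a).
Proof.
move=> Ba; have [_ star _] := vnB.
have [|T [b Bb bT] aT] := star (vn_act a); first by exists a.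
suff -> : vn_star a = b by [].
apply: vn_act_inj; rewrite bT.
exact: adjoint_pair_uniq (vn_act_star a) aT.
Qed.

(** The image of [B] is its own bicommutant, so membership is tested by commuting with its
    commutant, whose members are linear; boundedness is inherited from [A]. *)
Lemma von_neumann_subalgebra_closed : GRing.subalg_closed (mem B).
Proof.
have bicomm (a : A) :
    (forall S, commutant (vn_act @` B)%classic S -> vn_act a \o S = S \o vn_act a) ->
    B a.
  move=> aS; apply: vn_act_image; have [_ _ <-] := vnB; split=> //.
  by have [bnd _ _] := vn_range A; apply: bnd; exists a.
have comm S a u : commutant (vn_act @` B)%classic S -> B a ->
    S (vn_act a u) = vn_act a (S u).
  by move=> [_ /(_ (vn_act a)) SB] Ba; have /(congr1 (@^~ u)) := SB (ex_intro2 _ _ a Ba erefl).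
split=> [|c a b|a b]; rewrite !inE.
- by apply: bicomm => S _; apply/funext => u /=; rewrite !vn_act1.
- move=> Ba Bb; apply: bicomm => S BS; apply/funext => u /=.
  have [[linS _] _] := BS.
  by rewrite !vn_actP linS !(comm S).
- move=> Ba Bb; apply: bicomm => S BS; apply/funext => u /=.
  by rewrite !vn_actM !(comm S).
Qed.

Variable phi : {scalar A}.
Hypothesis hphi : noncommutative_probability_space phi.

(** For [d = e - e'], the element [vn_star d] lies in [B], so [phi (d * vn_star d) = 0]; traciality
    swaps the factors and faithfulness gives [d = 0]. *)
Lemma is_conditional_expectation_uniq (z e e' : A) :
  is_conditional_expectation phi B z e ->
  is_conditional_expectation phi B z e' -> e = e'.
Proof.
have [_ faith _ trace] := hphi; have [_ linB _] := von_neumann_subalgebra_closed.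
move=> [Be ze] [Be' ze']; apply/eqP; rewrite -subr_eq0; apply/eqP.
have Bd : B (e - e').
  by have := linB (-1) e' e; rewrite !inE scaleN1r addrC; apply.
apply: faith; rewrite trace mulrBl linearB /=.
by rewrite -ze -?ze' ?subrr //; exact: von_neumann_subalgebra_star.
Qed.

Lemma conditional_expectationE (z e : A) :
  is_conditional_expectation phi B z e -> conditional_expectation phi B z = e.
Proof.
move=> ze; apply: xget_unique => // e' ze'.
exact: is_conditional_expectation_uniq ze.
Qed.

End Subalgebras.

(** * The two formulas, from [phi_expansion] with [w = Y n] and with [w] in [B] *)

Unset Implicit Arguments.

Theorem proposition1p1 (R : realType) (A : vonNeumannAlgebra R)
    (phi : {scalar A}) (hphi : noncommutative_probability_space phi)
    (n : nat) (hn : (0 < n)%N) (X Y : nat -> A) :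
  (free_pair phi [set X i | i in [set i | (0 < i <= n)%N]]%classic
                 [set Y i | i in [set i | (0 < i <= n)%N]]%classic ->
   phi (\prod_(1 <= i < n.+1) (X i * Y i)) =
   \sum_(k < n) \sum_(i : k.-tuple 'I_n | increasing_tuple i)
      phi ((\prod_(l <- i) Y l) * Y n) *
      \prod_(j < k.+1)
         boolean_cumulant phi (interleave X Y (cut_point i j) (cut_point i j.+1)))
  /\
  (forall B : set A,
   von_neumann_subalgebra B ->
   (forall i, (0 < i < n)%N -> B (Y i)) ->
   free_pair phi B [set X i | i in [set i | (0 < i <= n)%N]]%classic ->
   let Z := (\prod_(1 <= i < n) (X i * Y i)) * X n in
   is_conditional_expectation phi B Z (conditional_expectation phi B Z) /\
   conditional_expectation phi B Z =
   \sum_(k < n) \sum_(i : k.-tuple 'I_n | increasing_tuple i)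
      (\prod_(j < k.+1)
          boolean_cumulant phi (interleave X Y (cut_point i j) (cut_point i j.+1))) *:
      \prod_(l <- i) Y l).
Proof.
have [[_ phi1] _ _ _] := hphi.
have cut_sumE : cut_sum n Y (fun a c => boolean_cumulant phi (interleave X Y a c)) n n =
    \sum_(k < n) \sum_(i : k.-tuple 'I_n | increasing_tuple i)
      (\prod_(j < k.+1)
          boolean_cumulant phi (interleave X Y (cut_point i j) (cut_point i j.+1))) *:
      \prod_(l <- i) Y l.
  (* [cut_sum] also asks that the path end below [n]: this is automatic for a cut in ['I_n], and is
     [hn] when there is no cut. *)
  apply: eq_bigr => k _; apply: eq_bigl => i.
  rewrite rcons_path andbC /increasing_tuple; case: path; rewrite ?andbF // andbT /=.
  by case: (tval i) => [|x s] //=; rewrite last_map ltn_ord.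
split=> [freeXY|B vnB BY freeBX Z].
  rewrite big_nat_recr //= mulrA.
  rewrite (@phi_expansion _ _ _ _ n X Y phi1 freeXY _ _ _ n n) ?hn ?leqnn //; first last.
  - by apply: sub_generated_algebra; exists n; rewrite /= ?hn ?leqnn.
  - by move=> i i_n; apply: sub_generated_algebra; exists i => //=; case/andP: i_n => -> /ltnW.
  - by move=> i i_n; apply: sub_generated_algebra; exists i.
  - by move=> b; exact: generated_algebra_closed.
  rewrite cut_sumE mulr_suml linear_sum; apply: eq_bigr => k _.
  rewrite mulr_suml linear_sum; apply: eq_bigr => i _.
  by rewrite -scalerAl linearZ mulrC.
have freeXB := free_pair_sym freeBX.
have [B1 linB mulB] := von_neumann_subalgebra_closed vnB.
(* The explicit sum is the witness for existence; uniqueness then makes it the value chosen by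
   [xget]. *)
have condZ : is_conditional_expectation phi B Z
    (cut_sum n Y (fun a c => boolean_cumulant phi (interleave X Y a c)) n n).
  split=> [|w Bw].
    have B0 : B 0.
      by have := linB (-1) 1 1 B1 B1; rewrite scaleN1r addNr inE.
    have BD a b : B a -> B b -> B (a + b).
      by move=> Ba Bb; have := linB 1 a b; rewrite !inE scale1r; apply.
    rewrite cut_sumE; apply: (big_ind B) => // k _; apply: (big_ind B) => // i incr.
    suff Bi : B (\prod_(l <- i) Y l).
      by have := linB (\prod_(j < k.+1) boolean_cumulant phi
          (interleave X Y (cut_point i j) (cut_point i j.+1))) _ _ (mem_set Bi) (mem_set B0);
        rewrite addr0 inE.
    rewrite big_seq; apply: (big_ind B) => [|a b Ba Bb|l li].
    - by rewrite inE in B1.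
    - by have := mulB a b; rewrite !inE; apply.
    (* An increasing path from [0] has positive entries, so each [Y l] is one of those assumed to
       lie in [B]. *)
    - apply: BY; rewrite ltn_ord andbT.
      move: incr; rewrite /increasing_tuple => /(order_path_min ltn_trans)/allP; apply.
      exact: map_f.
  rewrite (@phi_expansion _ _ _ _ n X Y phi1 freeXB _ _ _ n n) ?hn ?leqnn //; first last.
  - exact: sub_generated_algebra.
  - by move=> i i_n; apply: sub_generated_algebra; exact: BY.
  - by move=> i i_n; apply: sub_generated_algebra; exists i.
  - by move=> b; exact: generated_algebra_closed.
by rewrite (conditional_expectationE vnB hphi condZ) -cut_sumE.
Qed.
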